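(* Let $\mathcal{F}:\mathbb{R}^n\to\mathbb{R}^n$ be averaged non-expansive with $\mathrm{fix}(\mathcal{F})\neq\emptyset$, and let $\{z_k\}$ be generated by the adaptive acceleration algorithm A$^2$FoM applied to $\mathcal{F}$ (described in the context), which can be written as $z_{k+1}=\mathcal{F}(z_k+\varepsilon_k)$ with the perturbation $\varepsilon_k$ given in the context. If the perturbation error is absolutely summable, i.e. $\sum_k\|\varepsilon_k\|<+\infty$, then there exists $z^\star\in\mathrm{fix}(\mathcal{F})$ such that $z_k\to z^\star$.
   Context: $\mathcal{F}$ is $\alpha$-averaged ($\alpha\in]0,1[$) if $\mathcal{F}=\alpha\mathcal{F}'+(1-\alpha)\mathrm{Id}$ for some non-expansive ($1$-Lipschitz) $\mathcal{F}'$; averaged non-expansive means $\alpha$-averaged for some $\alpha\in]0,1[$. $\mathrm{fix}(\mathcal{F})=\{z:\mathcal{F}(z)=z\}$. $\rho(\cdot)$ is the spectral radius. Algorithm A$^2$FoM: fix integers $s\ge1$, $q\ge1$; start with $\bar z_0=z_0\in\mathbb{R}^n$ and $V_0=0\in\mathbb{R}^{n\times q}$. Put $v_k=z_k-z_{k-1}$ and $V_k=[v_k\,|\,v_{k-1}\,|\cdots|\,v_{k-q+1}]\in\mathbb{R}^{n\times q}$. Let $c_k\in\mathrm{Argmin}_{c\in\mathbb{R}^q}\|V_{k-1}c-v_k\|^2$ and $C_k=H(c_k)$, where for $c\in\mathbb{R}^q$ $$H(c)=\left[\begin{array}{c|c}c_{1:q-1}&\mathrm{Id}_{q-1}\\ c_q&0_{1,q-1}\end{array}\right]\in\mathbb{R}^{q\times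 q}.$$ The extrapolation is $\mathcal{E}_{s,q}(z_k,\dots,z_{k-q-1})=V_k\big(\sum_{i=1}^sC_k^i\big)_{(:,1)}$, where $(\cdot)_{(:,1)}$ is the first column. At iteration $k$ (with $\bar z_0=z_0$): if $\mathrm{mod}(k,q+2)=0$ and $\rho(C_k)<1$, set $\bar z_k=z_k+a_k\mathcal{E}_{s,q}(z_k,\dots,z_{k-q-1})$ with $a_k$ a real parameter; otherwise set $\bar z_k=z_k$. Then $z_{k+1}=\mathcal{F}(\bar z_k)$. The perturbation is $\varepsilon_k=\bar z_k-z_k$, that is, $\varepsilon_k=a_k\mathcal{E}_{s,q}(z_k,\dots,z_{k-q-1})$ if $\mathrm{mod}(k,q+2)=0$ and $\rho(C_k)<1$, and $\varepsilon_k=0$ if $\mathrm{mod}(k,q+2)\ne0$ or if $\mathrm{mod}(k,q+2)=0$ and $\rho(C_k)\ge1$. *)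

(* Defs.v *)
From mathcomp Require Import all_boot all_order all_algebra.
From mathcomp Require Import all_classical all_reals all_analysis.
From mathcomp Require Import complex.
Import Order.TTheory GRing.Theory Num.Theory.
Import numFieldNormedType.Exports.

Set Implicit Arguments.
Unset Strict Implicit.
Unset Printing Implicit Defensive.

Local Open Scope classical_set_scope.
Local Open Scope ring_scope.

(* The norm that the library puts on matrices is the sup norm; non-expansiveness
   and the least-squares problem need the Euclidean one. *)
Definition enorm (R : realType) (n : nat) (x : 'cV[R]_n) : R :=
  Num.sqrt (\sum_i x i 0 ^+ 2).

Definition nonexpansive (R : realType) (n : nat) (F : 'cV[R]_n -> 'cV[R]_n) :=
  forall x y, enorm (F x - F y) <= enorm (x - y).

Definition alpha_averaged (R : realType) (n : nat) (alpha : R)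
    (F : 'cV[R]_n -> 'cV[R]_n) :=
  exists2 F' : 'cV[R]_n -> 'cV[R]_n,
    nonexpansive F' & forall x, F x = alpha *: F' x + (1 - alpha) *: x.

Definition averaged_nonexpansive (R : realType) (n : nat)
    (F : 'cV[R]_n -> 'cV[R]_n) :=
  exists alpha : R, 0 < alpha < 1 /\ alpha_averaged alpha F.

Definition fix_set (T : Type) (F : T -> T) : set T := [set z | F z = z].

(* For q > 0 the set is finite and nonempty, so that sup is a maximum. *)
Definition spectral_radius (R : realType) (q : nat) (A : 'M[R]_q) : R :=
  sup [set Normc.normc l |
        l in [set l : R[i] | eigenvalue (map_mx (real_complex R) A) l]].

Definition argmin (R : realType) (T : Type) (f : T -> R) : set T :=
  [set x | forall y, f x <= f y].

(* As 0.-1 = 0, this gives v_0 = 0. *)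
Definition vdiff (R : realType) (n : nat) (z : nat -> 'cV[R]_n) (k : nat) :
    'cV[R]_n :=
  z k - z k.-1.

(* The columns are v_k, v_(k-1), ..., v_(k-q+1). Subtraction is truncated and
   v_0 = 0, so the columns with index at most 0 vanish; in particular V_0 = 0. *)
Definition vmatrix (R : realType) (n q : nat) (z : nat -> 'cV[R]_n) (k : nat) :
    'M[R]_(n, q) :=
  \matrix_(i < n, j < q) vdiff z (k - j) i 0.

Definition lsq_coef (R : realType) (n q : nat) (z : nat -> 'cV[R]_n) (k : nat) :
    set 'cV[R]_q :=
  argmin (fun c => enorm (vmatrix q z k.-1 *m c - vdiff z k) ^+ 2).

(* c is the first column; column j > 0 is the basis vector number j - 1. *)
Definition companion (R : realType) (q : nat) (c : 'cV[R]_q) : 'M[R]_q :=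
  \matrix_(i < q, j < q) if j == 0%N :> nat then c i 0 else (i.+1 == j)%:R.

Definition extrapolation (R : realType) (n s q : nat) (q_gt0 : (0 < q)%N)
    (z : nat -> 'cV[R]_n) (c : 'cV[R]_q) (k : nat) : 'cV[R]_n :=
  vmatrix q z k *m
    col (Ordinal q_gt0) (\sum_(1 <= i < s.+1) companion c ^+ i).

(* a is the sequence of step parameters, c a choice of least-squares solutions,
   and zbar the sequence of extrapolated points. *)
Record A2FoM (R : realType) (n s q : nat) (q_gt0 : (0 < q)%N)
    (F : 'cV[R]_n -> 'cV[R]_n) (a : nat -> R) (c : nat -> 'cV[R]_q)
    (z zbar : nat -> 'cV[R]_n) : Prop := {
  A2FoM_init : zbar 0%N = z 0%N ;
  A2FoM_coef : forall k, (0 < k)%N -> lsq_coef z k (c k) ;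
  A2FoM_extrapolate : forall k, (0 < k)%N ->
    zbar k = if (k %% q.+2 == 0)%N && (spectral_radius (companion (c k)) < 1)
             then z k + a k *: extrapolation s q_gt0 z (c k) k
             else z k ;
  A2FoM_step : forall k, z k.+1 = F (zbar k)
}.

Definition perturbation (R : realType) (n : nat) (z zbar : nat -> 'cV[R]_n)
    (k : nat) : 'cV[R]_n :=
  zbar k - z k.

(* Main.v *)
(* Quasi-Fejer monotonicity: for every fixed point y of F one has
   |z_(k+1) - y| <= |z_k - y| + |eps_k|, and since the eps_k are summable the
   distances |z_k - y| converge.  Averagedness strengthens non-expansiveness to
   |F x - y|^2 + theta |F x - x|^2 <= |x - y|^2 with theta > 0, which forces
   F zbar_k - zbar_k --> 0.  Any cluster point p of the bounded sequence z is
   then a fixed point, so |z_k - p| converges, and its limit must be 0. *)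
Require Import Defs.
From mathcomp Require Import all_boot all_order all_algebra.
From mathcomp Require Import all_classical all_reals all_analysis.
From mathcomp Require Import ring lra.
Import Order.TTheory GRing.Theory Num.Theory.
Import numFieldNormedType.Exports.

Set Implicit Arguments.
Unset Strict Implicit.
Unset Printing Implicit Defensive.

Local Open Scope classical_set_scope.
Local Open Scope ring_scope.

(** * The Euclidean norm and its comparison with the sup-norm topology *)

Section Enorm.
Variables (R : realType) (n : nat).
Implicit Types x y : 'cV[R]_n.

(** Expanding the nonnegative sum of the [(A * g i - B * f i) ^+ 2] gives [A * (A * C - B ^+ 2)].
    One divides by [A] when it is positive; when it is zero, every [f i] vanishes. *)
Lemma sum_cauchy_schwarz (I : finType) (f g : I -> R) :
  (\sum_i f i * g i) ^+ 2 <= (\sum_i f i ^+ 2) * (\sum_i g i ^+ 2).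
Proof.
set A := \sum_i f i ^+ 2; set B := \sum_i f i * g i; set C := \sum_i g i ^+ 2.
have A_ge0 : 0 <= A by apply: sumr_ge0 => i _; exact: sqr_ge0.
have ABC : 0 <= A * (A * C - B ^+ 2).
  have -> : A * (A * C - B ^+ 2) = \sum_i (A * g i - B * f i) ^+ 2.
    under eq_bigr => i _.
      rewrite (_ : _ ^+ 2 = A ^+ 2 * g i ^+ 2 - 2 * A * B * (f i * g i)
                          + B ^+ 2 * f i ^+ 2); last by ring.
      over.
    rewrite big_split sumrB /= -!mulr_sumr -/A -/B -/C; ring.
  by apply: sumr_ge0 => i _; exact: sqr_ge0.
have [A_gt0|] := ltP 0 A; first by rewrite -subr_ge0 -(pmulr_rge0 _ A_gt0).
move=> A_le0; have /eqP A0 : A == 0 by rewrite eq_le A_le0.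
have f0 i : f i = 0.
  apply/eqP; rewrite -sqrf_eq0; apply/eqP.
  by apply: (psumr_eq0P _ A0) => // j _; exact: sqr_ge0.
by rewrite A0 mul0r /B big1 ?expr0n// => i _; rewrite f0 mul0r.
Qed.

Lemma enorm_ge0 x : 0 <= enorm x.
Proof. exact: sqrtr_ge0. Qed.

Lemma sqr_enorm x : enorm x ^+ 2 = \sum_i x i 0 ^+ 2.
Proof. by rewrite sqr_sqrtr//; apply: sumr_ge0 => i _; exact: sqr_ge0. Qed.

Lemma enormN x : enorm (- x) = enorm x.
Proof. by congr Num.sqrt; apply: eq_bigr => i _; rewrite mxE sqrrN. Qed.

Lemma enormB x y : enorm (x - y) = enorm (y - x).
Proof. by rewrite -enormN opprB. Qed.

Lemma sqr_enormZ a x : enorm (a *: x) ^+ 2 = a ^+ 2 * enorm x ^+ 2.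
Proof.
rewrite !sqr_enorm mulr_sumr; apply: eq_bigr => i _.
by rewrite mxE exprMn.
Qed.

Lemma enorm_triangle x y : enorm (x + y) <= enorm x + enorm y.
Proof.
rewrite -(@ler_pXn2r _ 2) ?nnegrE ?addr_ge0 ?enorm_ge0//.
set B := \sum_i x i 0 * y i 0.
have -> : enorm (x + y) ^+ 2 = enorm x ^+ 2 + 2 * B + enorm y ^+ 2.
  rewrite !sqr_enorm mulr_sumr -!big_split; apply: eq_bigr => i _.
  by rewrite /= mxE; ring.
suff : B <= enorm x * enorm y by rewrite sqrrD; lra.
apply: le_trans (ler_norm _) _.
rewrite -(@ler_pXn2r _ 2) ?nnegrE ?mulr_ge0 ?enorm_ge0//.
by rewrite real_normK ?num_real// exprMn !sqr_enorm sum_cauchy_schwarz.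
Qed.

Lemma enorm_le_dist x y : enorm x <= enorm y + enorm (x - y).
Proof. by rewrite -{1}(subrK y x) addrC enorm_triangle. Qed.

Lemma le_coord_enorm x i : `|x i 0| <= enorm x.
Proof.
rewrite -sqrtr_sqr ler_sqrt; last by apply: sumr_ge0 => j _; exact: sqr_ge0.
by rewrite (bigD1 i)//= lerDl; apply: sumr_ge0 => j _; exact: sqr_ge0.
Qed.

Lemma enorm0_eq0 x : enorm x = 0 -> x = 0.
Proof.
move=> x0; apply/colP => i; rewrite mxE; apply/eqP.
by rewrite -normr_le0 -x0 le_coord_enorm.
Qed.

Lemma enorm_le_sum x : enorm x <= \sum_i `|x i 0|.
Proof.
have S_ge0 : 0 <= \sum_i `|x i 0| by exact: sumr_ge0.
rewrite -(@ler_pXn2r _ 2) ?nnegrE ?enorm_ge0// sqr_enorm expr2 mulr_suml.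
apply: ler_sum => i _; rewrite -real_normK ?num_real// expr2 ler_wpM2l//.
by rewrite (bigD1 i)//= lerDl sumr_ge0.
Qed.

(** Neighbourhoods come from the sup norm. The Euclidean norm is at most the sum of the absolute
    coordinates, so a sup ball of radius [e / n.+1] suffices; [n.+1] instead of [n] makes the final
    bound strict and covers [n = 0]. *)
Lemma nbhs_enorm_ball x (e : R) : 0 < e -> nbhs x [set y | enorm (y - x) < e].
Proof.
move=> e_gt0; apply/nbhs_ballP; exists (e / n.+1%:R).
  by rewrite /= divr_gt0// ltr0n.
move=> y [_ xy] /=; apply: le_lt_trans (enorm_le_sum _) _.
apply: (@le_lt_trans _ _ (\sum_(i < n) e / n.+1%:R)).
  apply: ler_sum => i _; rewrite !mxE distrC; apply: ltW; exact: xy.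
rewrite sumr_const card_ord -[_ *+ n]mulr_natr -mulrA gtr_pMr//.
by rewrite mulrC ltr_pdivrMr ?ltr0n// mul1r ltr_nat.
Qed.

Lemma cvg_enorm (u : nat -> 'cV[R]_n) x :
  enorm (u k - x) @[k --> \oo] --> 0 -> u @ \oo --> x.
Proof.
move=> /cvgrPdist_lt u_cvg; apply/cvg_ballP => e e_gt0.
near=> k; split=> // i j; rewrite ord1 /ball/= distrC.
have := le_coord_enorm (u k - x) i; rewrite !mxE => /le_lt_trans; apply.
suff : `|0 - enorm (u k - x)| < e by rewrite sub0r normrN ger0_norm ?enorm_ge0.
by near: k; exact: u_cvg.
Unshelve. all: by end_near. Qed.

(** Bolzano-Weierstrass: the Euclidean bound puts the sequence in the box [[- M, M]] to the power
    [n], which is compact. The transposes are there because [rV_compact] concerns row vectors. *)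
Lemma bounded_has_cluster (u : nat -> 'cV[R]_n) (M : R) :
  (forall k, enorm (u k) <= M) ->
  exists p, forall e N, 0 < e -> exists2 k, (N <= k)%N & enorm (u k - p) < e.
Proof.
move=> u_le.
have K_compact := @rV_compact R n (fun=> [set` `[- M, M]])
  (fun=> @segment_compact _ _ _).
have FK : ((fun k => (u k)^T) @ \oo)
    [set v : 'rV[R]_n | forall i, v ord0 i \in `[- M, M]].
  exists 0%N => // k _ i; rewrite mxE in_itv/= -ler_norml.
  exact: le_trans (le_coord_enorm _ _) (u_le k).
have [p [_ clp]] := K_compact _ _ FK.
exists p^T => e N e_gt0.
have pe : nbhs p [set v : 'rV[R]_n | enorm (v^T - p^T) < e].
  have /nbhs_ballP[r /= r_gt0 rP] := nbhs_enorm_ball p^T e_gt0.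
  apply/nbhs_ballP; exists r => //= v [_ pv]; apply: rP; split=> // i j.
  by rewrite !mxE; exact: pv.
(* The tail from [N] on belongs to the filter, so it meets every neighbourhood of the cluster
   point. *)
have uN : ((fun k => (u k)^T) @ \oo)
    [set v | exists2 k, (N <= k)%N & v = (u k)^T].
  by exists N => // k /= Nk; exists k.
have [_ [[k Nk ->]] /=] := clp _ _ uN pe.
by rewrite trmxK; exists k.
Qed.

End Enorm.

(** * Averaged operators *)

Section Averaged.
Variables (R : realType) (n : nat) (F : 'cV[R]_n -> 'cV[R]_n).

(** A polynomial identity in each coordinate, valid for every real [t]. Its last term is what
    averagedness gains over plain non-expansiveness. *)
Lemma sqr_enorm_convex (t : R) (u v : 'cV[R]_n) :
  enorm (t *: u + (1 - t) *: v) ^+ 2 =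
  t * enorm u ^+ 2 + (1 - t) * enorm v ^+ 2 - t * (1 - t) * enorm (u - v) ^+ 2.
Proof.
rewrite !sqr_enorm !mulr_sumr -big_split -sumrB; apply: eq_bigr => i _.
by rewrite /= !mxE; ring.
Qed.

Lemma averaged_is_nonexpansive : averaged_nonexpansive F -> nonexpansive F.
Proof.
move=> [t [/andP[t0 t1] [G G_ne FE]]] x y.
rewrite -(@ler_pXn2r _ 2) ?nnegrE ?enorm_ge0//.
have -> : F x - F y = t *: (G x - G y) + (1 - t) *: (x - y).
  by rewrite !FE !scalerBr opprD addrACA.
have : enorm (G x - G y) ^+ 2 <= enorm (x - y) ^+ 2.
  by rewrite ler_pXn2r ?nnegrE ?enorm_ge0.
rewrite sqr_enorm_convex => /(ler_wpM2l (ltW t0)).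
have : 0 <= t * (1 - t) * enorm (G x - G y - (x - y)) ^+ 2.
  by apply: mulr_ge0 (sqr_ge0 _); apply: mulr_ge0; rewrite ?subr_ge0 ltW.
lra.
Qed.

Lemma averaged_residual : averaged_nonexpansive F ->
  exists2 theta : R, 0 < theta & forall x y, fix_set F y ->
    theta * enorm (F x - x) ^+ 2 <= enorm (x - y) ^+ 2 - enorm (F x - y) ^+ 2.
Proof.
move=> [t [/andP[t0 t1] [G G_ne FE]]].
(* Since [F x - x = t *: (G x - x)], the gain [t * (1 - t) * enorm (G x - x) ^+ 2] equals
   [(1 - t) / t * enorm (F x - x) ^+ 2]. *)
exists ((1 - t) / t); first by rewrite divr_gt0// subr_gt0.
move=> x y Fy.
have Gy : G y = y.
  apply: (scalerI (lt0r_neq0 t0)); apply: (addIr ((1 - t) *: y)).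
  by rewrite -FE -scalerDl addrC subrK scale1r.
have -> : F x - y = t *: (G x - y) + (1 - t) *: (x - y).
  rewrite FE !scalerBr addrACA -opprD -scalerDl.
  by rewrite [t + _]addrC subrK scale1r.
have -> : F x - x = t *: (G x - y - (x - y)).
  rewrite FE opprB addrA subrK scalerBl scale1r scalerBr.
  by rewrite -addrA [x - _ - x]addrAC subrr sub0r.
have : enorm (G x - y) ^+ 2 <= enorm (x - y) ^+ 2.
  by rewrite -{1}Gy ler_pXn2r ?nnegrE ?enorm_ge0.
rewrite sqr_enormZ sqr_enorm_convex => /(ler_wpM2l (ltW t0)).
rewrite (_ : (1 - t) / t * _ = t * (1 - t) * enorm (G x - y - (x - y)) ^+ 2).
  lra.
by field; rewrite gt_eqF.
Qed.

End Averaged.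

(** Subtracting the partial sums of [e] from [d] leaves a nonincreasing sequence, bounded below by
    minus the sum of the series. *)
Lemma quasi_fejer_cvg (R : realType) (d e : nat -> R) :
  (forall k, 0 <= d k) -> (forall k, 0 <= e k) -> cvgn (series e) ->
  (forall k, d k.+1 <= d k + e k) -> cvgn d.
Proof.
move=> d_ge0 e_ge0 e_cvg d_le.
have -> : d = (fun k => d k - series e k) \+ series e.
  by apply/funext => k /=; rewrite subrK.
apply: is_cvgD => //; apply: nonincreasing_is_cvgn.
  apply/nonincreasing_seqP => k.
  rewrite seriesEnat /= big_nat_recr//= opprD addrA.
  by have := d_le k; lra.
exists (- limn (series e)) => _ [k _ <-].
have : series e k <= limn (series e).
  by apply: nondecreasing_cvgn_le => //; exact/nondecreasing_series.
by have := d_ge0 k; lra.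
Qed.

(** * Convergence of iterations with summable perturbations *)

Section PerturbedIteration.
Variables (R : realType) (n : nat) (F : 'cV[R]_n -> 'cV[R]_n).
Variables z w : nat -> 'cV[R]_n.
Hypothesis F_averaged : averaged_nonexpansive F.
Hypothesis zE : forall k, z k.+1 = F (w k).
Hypothesis eps_cvg : cvgn (series (fun k => enorm (w k - z k))).

Let eps_cvg0 : enorm (w k - z k) @[k --> \oo] --> 0.
Proof. exact: cvg_series_cvg_0. Qed.

Lemma dist_fix_cvg y : fix_set F y -> cvgn (fun k => enorm (z k - y)).
Proof.
move=> Fy; apply: (quasi_fejer_cvg _ _ eps_cvg) => [k|k|k].
- exact: enorm_ge0.
- exact: enorm_ge0.
rewrite zE -{1}Fy; apply: le_trans (averaged_is_nonexpansive F_averaged _ _) _.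
apply: le_trans (enorm_le_dist _ (z k - y)) _.
by rewrite opprB addrA subrK.
Qed.

Lemma residual_cvg0 y : fix_set F y ->
  enorm (F (w k) - w k) @[k --> \oo] --> 0.
Proof.
move=> Fy; have /cvg_ex[/= l zl] := dist_fix_cvg Fy.
(* [enorm (w k - y)] differs from [enorm (z k - y)] by at most [enorm (w k - z k)], which tends to
   0. *)
have wl : enorm (w k - y) @[k --> \oo] --> l.
  apply: (@squeeze_cvgr _ _ _ _ (fun k => enorm (z k - y) - enorm (w k - z k))
           (fun k => enorm (z k - y) + enorm (w k - z k))).
  - apply: nearW => k; have := enorm_le_dist (w k - y) (z k - y).
    have := enorm_le_dist (z k - y) (w k - y).
    rewrite !opprB !addrA !subrK (enormB (z k) (w k)) => ? ?.
    by apply/andP; split; lra.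
  - by rewrite -[l]subr0; exact: cvgB.
  - by rewrite -[l]addr0; exact: cvgD.
have [theta theta_gt0 resE] := averaged_residual F_averaged.
(* As [z k.+1] is [F (w k)], this is the upper bound that [averaged_residual] puts on the squared
   residual; both distances have the limit [l]. *)
have gap0 : theta^-1 * (enorm (w k - y) ^+ 2 - enorm (z k.+1 - y) ^+ 2)
    @[k --> \oo] --> 0.
  rewrite -[X in _ --> X](mulr0 theta^-1) -(subrr (l ^+ 2)).
  apply: cvgMr; apply: cvgB; first by apply: (@cvgM R); exact: wl.
  have /= zl1 : enorm (z k.+1 - y) @[k --> \oo] --> l.
    by rewrite (cvg_shiftS (fun k => enorm (z k - y))).
  by apply: (@cvgM R); exact: zl1.
have res2 : enorm (F (w k) - w k) ^+ 2 @[k --> \oo] --> 0.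
  apply: (squeeze_cvgr _ (cvg_cst 0) gap0); apply: nearW => k.
  by rewrite sqr_ge0 /= ler_pdivlMl// zE; exact: resE.
have -> : (fun k => enorm (F (w k) - w k)) =
          (fun k => Num.sqrt (enorm (F (w k) - w k) ^+ 2)).
  by apply/funext => k; rewrite sqrtr_sqr ger0_norm ?enorm_ge0.
rewrite -[X in _ --> X](@sqrtr0 R).
exact: (continuous_cvg _ (@sqrt_continuous R 0)).
Qed.

Lemma perturbed_iteration_cvg : fix_set F !=set0 ->
  exists2 p, fix_set F p & z @ \oo --> p.
Proof.
move=> [y Fy].
have [M z_le] : exists M, forall k, enorm (z k) <= M.
  (* Boundedness provides a bound for each number strictly above [M], hence the choice of
     [M + 1]. *)
  have /cvg_seq_bounded[M [_ /(_ (M + 1))]] := dist_fix_cvg Fy.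
  rewrite ltrDl ltr01 => /(_ isT) dM; exists (enorm y + (M + 1)) => k.
  apply: le_trans (enorm_le_dist _ y) _; rewrite lerD2l.
  by apply: le_trans (ler_norm _) _; exact: dM.
have [p clp] := bounded_has_cluster z_le.
have Fp : fix_set F p.
  apply/eqP; rewrite -subr_eq0; apply/eqP/enorm0_eq0/eqP.
  rewrite eq_le enorm_ge0 andbT; apply/ler_addgt0Pr => e e_gt0; rewrite add0r.
  (* Passing through [F (w k)] and then [w k] bounds [enorm (F p - p)] by twice [enorm (w k - p)]
     plus the residual. Splitting [w k - p] at [z k] makes five terms, each below [e / 5] for a
     suitable [k]. *)
  have e5 : 0 < e / 5 by lra.
  have [N1 _ res_lt] := cvgr0_norm_lt _ (residual_cvg0 Fy) _ e5.
  have [N2 _ eps_lt] := cvgr0_norm_lt _ eps_cvg0 _ e5.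
  have [k] := clp _ (maxn N1 N2) e5.
  rewrite geq_max => /andP[N1k N2k] zp.
  have := res_lt k N1k; have := eps_lt k N2k.
  rewrite /= !ger0_norm ?enorm_ge0//.
  have := averaged_is_nonexpansive F_averaged (w k) p.
  have := enorm_le_dist (F p - p) (F (w k) - p).
  have := enorm_le_dist (F (w k) - p) (w k - p).
  have := enorm_le_dist (w k - p) (z k - p).
  rewrite !opprB !addrA !subrK (enormB (F p) (F _)); lra.
exists p => //; apply: cvg_enorm.
have /cvg_ex[/= l zl] := dist_fix_cvg Fp.
suff <- : l = 0 by [].
apply/eqP; rewrite eq_le; apply/andP; split; last first.
  rewrite -(cvg_lim _ zl)//; apply: limr_ge; first exact: cvgP zl.
  by apply: nearW => k; exact: enorm_ge0.
(* Some [k] beyond [N] has [z k] within [e / 2] of the cluster point [p], while [enorm (z k - p)] is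
   already within [e / 2] of [l]. *)
apply/ler_addgt0Pr => e e_gt0; rewrite add0r.
have e2 : 0 < e / 2 by lra.
have [N _ zl_lt] := cvgr_dist_lt _ _ zl _ e2.
have [k Nk zp] := clp _ N e2.
have := zl_lt k Nk; have := ler_norm (l - enorm (z k - p)); rewrite /=; lra.
Qed.

End PerturbedIteration.

Theorem theorem5p3 (R : realType) (n s q : nat) (s_gt0 : (0 < s)%N)
    (q_gt0 : (0 < q)%N) (F : 'cV[R]_n -> 'cV[R]_n) (a : nat -> R)
    (c : nat -> 'cV[R]_q) (z zbar : nat -> 'cV[R]_n)
    (F_averaged : averaged_nonexpansive F)
    (fixF_neq0 : fix_set F !=set0)
    (z_A2FoM : A2FoM s q_gt0 F a c z zbar)
    (eps_summable :
      (\sum_(0 <= k <oo) (enorm (perturbation z zbar k))%:E < +oo)%E) :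
  exists2 zstar : 'cV[R]_n, fix_set F zstar & z @ \oo --> zstar.
Proof.
apply: (perturbed_iteration_cvg F_averaged (A2FoM_step z_A2FoM)) => //.
(* A finite extended-real sum of nonnegative terms means that the real partial sums converge. *)
by apply: nnseries_is_cvg eps_summable => k; exact: enorm_ge0.
Qed.
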